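(* Let $\alpha\in(0,1)$ be irrational. For every limit $\ell\in\mathbb{Z}_{\ge0}\cup\{\infty\}$ and every left-admissible digit string $\langle c_k\rangle_1^\ell$, we have $\sum_{k=1}^\ell c_k\theta_{k-1}\in[-\alpha,1-\alpha)$. Furthermore, for every $\gamma\in[-\alpha,1-\alpha)$ there exist a unique limit $\ell\in\mathbb{Z}_{\ge0}\cup\{\infty\}$ and a unique left-admissible digit string $\langle c_k\rangle_1^\ell$ such that $\gamma=\sum_{k=1}^\ell c_k\theta_{k-1}$.
   Context: For irrational $\alpha\in(0,1)$, set $\alpha_0=\alpha$ and, for $k\ge1$, $a_k=\lfloor 1/\alpha_{k-1}\rfloor$, $\alpha_k=1/\alpha_{k-1}-a_k$ (the continued fraction digits of $\alpha$). Let $p_{-1}=1,\ p_0=0,\ p_k=a_kp_{k-1}+p_{k-2}$ and $q_{-1}=0,\ q_0=1,\ q_k=a_kq_{k-1}+q_{k-2}$ for $k\ge1$, and $\theta_k=q_k\alpha-p_k$ for $k\ge-1$. For $\ell\in\mathbb{Z}_{\ge0}\cup\{\infty\}$, an integer sequence $\langle c_k\rangle_1^\ell$ (empty if $\ell=0$; indexed by all $k\ge1$ if $\ell=\infty$) is a left-admissible digit string if (i) $0\le c_k\le a_k$ for all $k<\ell+1$; if $1\le\ell<\infty$ then $c_\ell\ge1$; if $\ell=\infty$ then $c_k\ge1$ for infinitely many $k$; (ii) $c_k=a_k\implies c_{k-1}=0$ for $2\le k<\ell+1$; (iii) $c_1\le a_1-1$ (when $\ell\ge1$), and if $\ell=\infty$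 then $c_k\le a_k-1$ for infinitely many odd $k$. Here $\infty+1=\infty$. *)

(* Defs.v *)
From HB Require Import structures.
From mathcomp Require Import all_boot all_order all_algebra.
From mathcomp Require Import all_classical all_reals all_analysis.

Set Implicit Arguments.
Unset Strict Implicit.
Unset Printing Implicit Defensive.

Import Order.TTheory GRing.Theory Num.Theory.
Import numFieldNormedType.Exports.

Local Open Scope classical_set_scope.
Local Open Scope ring_scope.

(* alpha_k *)
Fixpoint cf_rem (R : realType) (alpha : R) (k : nat) : R :=
  if k is j.+1 then
    1 / cf_rem alpha j - (Num.floor (1 / cf_rem alpha j))%:~R
  else alpha.

(* a_k for k >= 1; the value at k = 0 is junk and never used *)
Definition cf_digit (R : realType) (alpha : R) (k : nat) : int :=
  Num.floor (1 / cf_rem alpha k.-1).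

(* The sequences p, q, theta start at index -1, hence the shift by one:
   the value at k is p_{k-1}, q_{k-1}, theta_{k-1} respectively. *)
Fixpoint cf_num_pred (R : realType) (alpha : R) (k : nat) : int :=
  match k with
  | 0%N => 1
  | 1%N => 0
  | (i.+1 as j).+1 =>
      cf_digit alpha j * cf_num_pred alpha j + cf_num_pred alpha i
  end.

Fixpoint cf_den_pred (R : realType) (alpha : R) (k : nat) : int :=
  match k with
  | 0%N => 0
  | 1%N => 1
  | (i.+1 as j).+1 =>
      cf_digit alpha j * cf_den_pred alpha j + cf_den_pred alpha i
  end.

Definition cf_theta_pred (R : realType) (alpha : R) (k : nat) : R :=
  (cf_den_pred alpha k)%:~R * alpha - (cf_num_pred alpha k)%:~R.

(* A limit l is [Some n] when finite and [None] when infinite.  A string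
   <c_k>_1^l is represented by a function c : nat -> int of which only the
   values at the indices 1 <= k < l + 1 are meaningful. *)
Definition is_index (l : option nat) (k : nat) : bool :=
  (1 <= k)%N && (if l is Some n then (k < n.+1)%N else true).

Definition same_string (l : option nat) (c d : nat -> int) : Prop :=
  forall k, is_index l k -> c k = d k.

Definition left_admissible (R : realType) (alpha : R)
    (l : option nat) (c : nat -> int) : Prop :=
  [/\ (forall k, is_index l k -> 0 <= c k <= cf_digit alpha k)
      /\ match l with
         | Some n => (1 <= n)%N -> 1 <= c n
         | None => infinite_set [set k | is_index l k /\ 1 <= c k]
         end,
      (forall k, (2 <= k)%N -> is_index l k ->
         c k = cf_digit alpha k -> c k.-1 = 0)
    & (is_index l 1 -> c 1%N <= cf_digit alpha 1 - 1)
      /\ (l = None ->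
          infinite_set
            [set k | [/\ is_index l k, odd k & c k <= cf_digit alpha k - 1]])].

(* s = \sum_(k = 1)^l c_k theta_{k-1}, as a convergent series if l is infinite *)
Definition digit_sum_is (R : realType) (alpha : R)
    (l : option nat) (c : nat -> int) (s : R) : Prop :=
  let S (n : nat) : R :=
    \sum_(1 <= k < n.+1) (c k)%:~R * cf_theta_pred alpha k in
  match l with
  | Some n => s = S n
  | None => S n @[n --> \oo] --> s
  end.

(* Main.v *)
(* Up to the sign (-1)^(k-1), theta_(k-1) is P_k = alpha_0 ... alpha_(k-1), and
   P_k = a_(k+1) P_(k+1) + P_(k+2).  The values of the admissible tails
   sum_(k > i) c_k theta_(k-1) fill a half-open interval that depends only on
   i and on whether c_i = 0.  Fixing the leading digit c_(i+1) cuts this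
   interval into disjoint translates of intervals of index i + 1, one for each
   allowed digit; this produces the digits of gamma one by one and shows that
   they are unique.  The condition on odd digits is what excludes the upper end
   of the interval, which would be reached by maximal odd digits. *)
Require Import Defs.
From mathcomp Require Import all_boot all_order all_algebra.
From mathcomp Require Import all_classical all_reals all_analysis.
From mathcomp Require Import ring lra zify.
Import Order.TTheory GRing.Theory Num.Theory.
Import numFieldNormedType.Exports.
Local Open Scope classical_set_scope.
Local Open Scope ring_scope.

Lemma infinite_set_natP (A : set nat) :
  infinite_set A <-> forall n, exists2 k, (n <= k)%N & A k.
Proof.
split=> [Ainf n | Aunb Afin].
  apply: contrapT => nA; apply: Ainf; apply: (sub_finite_set _ (finite_II n)).
  move=> k Ak /=; rewrite ltnNge; apply/negP => nk; apply: nA.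
  by exists k.
have [s As] := (finite_seqP A).1 Afin.
have [k] := Aunb (\max_(i <- s) i).+1; rewrite As /= => + ks.
by rewrite ltnNge leq_bigmax_seq.
Qed.

(** * Remainders, digits and the size of theta *)

Section ContinuedFraction.
Variables (R : realType) (alpha : R).
Hypotheses (alpha_irr : irrational alpha) (alpha01 : 0 < alpha < 1).

Local Notation a k := (cf_digit alpha k).
Local Notation T k := (cf_theta_pred alpha k).

Lemma cf_rem_irrational k : irrational (cf_rem alpha k).
Proof.
elim: k => [//|k IH] [/= r _ /eqP]; rewrite eq_sym subr_eq => /eqP Er.
apply: IH; exists (r + (Num.floor (1 / cf_rem alpha k))%:~R)^-1 => //.
by rewrite fmorphV rmorphD /= ratr_int -Er div1r invrK.
Qed.

Lemma cf_rem_gt0_lt1 k : 0 < cf_rem alpha k < 1.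
Proof.
case: k => [//|k]; rewrite [cf_rem _ _]/= subr_gt0 ltrBlDr.
set x := 1 / _; have /andP[x0 x1] := floor_itv x.
rewrite [1 + _]addrC -[1]/(1%:~R) -intrD x1 andbT lt_neqAle x0 andbT.
apply/eqP => E; apply: (cf_rem_irrational k.+1) => /=.
by exists 0 => //; rewrite E subrr rmorph0.
Qed.

Lemma cf_digit_ge1 k : 1 <= a k.
Proof.
rewrite /cf_digit floor_ge_int; have /andP[r0 r1] := cf_rem_gt0_lt1 k.-1.
by rewrite ler_pdivlMr // mul1r ltW.
Qed.

Definition theta_abs (k : nat) : R := \prod_(j < k) cf_rem alpha j.
Local Notation P := theta_abs.

Lemma theta_abs_gt0 k : 0 < P k.
Proof. by apply: prodr_gt0 => j _; case/andP: (cf_rem_gt0_lt1 j). Qed.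

(** This is [P k] times the identity 1 = alpha_k (a_(k+1) + alpha_(k+1)). *)
Lemma theta_abs_rec k : P k = (a k.+1)%:~R * P k.+1 + P k.+2.
Proof.
rewrite /theta_abs !big_ord_recr /= /cf_digit /=.
have /andP[r0 _] := cf_rem_gt0_lt1 k.
by field; rewrite gt_eqF.
Qed.

Lemma theta_abs_lt k : P k.+1 < P k.
Proof.
rewrite /theta_abs big_ord_recr /= gtr_pMr; last exact: theta_abs_gt0.
by case/andP: (cf_rem_gt0_lt1 k).
Qed.

Lemma theta_absE k : T k = (-1) ^+ k.+1 * P k.
Proof.
suff [] : T k = (-1) ^+ k.+1 * P k /\ T k.+1 = (-1) ^+ k.+2 * P k.+1 by [].
elim: k => [|k [IH1 IH2]]; last split=> //.
  rewrite /cf_theta_pred /theta_abs /= big_ord0 big_ord1 /=.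
  by split; rewrite ?mul0r ?expr1 ?mul1r ?subr0 ?sub0r ?mulr1 // sqrrN expr1n mul1r.
have -> : T k.+2 = (a k.+1)%:~R * T k.+1 + T k.
  by rewrite /cf_theta_pred [cf_den_pred _ k.+2]/= [cf_num_pred _ k.+2]/=
    !rmorphD !rmorphM /=; ring.
by rewrite IH1 IH2 (theta_abs_rec k) !exprS; ring.
Qed.

(** Since every digit is at least 1, P_(k+1) + P_(k+2) <= P_k; the limit L of this decreasing
    sequence then satisfies 2L <= L. *)
Lemma theta_abs_cvg0 : P @ \oo --> (0 : R).
Proof.
have Pdec : nonincreasing_seq P.
  by apply/nonincreasing_seqP => n; exact/ltW/theta_abs_lt.
have Pc : cvgn P.
  apply: nonincreasing_is_cvgn => //; exists 0 => _ [n _ <-].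
  exact/ltW/theta_abs_gt0.
set L := limn P in Pc *.
have L0 : 0 <= L.
  by apply: limr_ge => //; near=> n; exact/ltW/theta_abs_gt0.
have PS : P n.+1 @[n --> \oo] --> L by rewrite cvg_shiftS.
have PSS : P n.+2 @[n --> \oo] --> L by rewrite (@cvg_shiftS _ (fun n => P n.+1)).
have : L + L <= L.
  apply: (ler_cvg_to (cvgD PS PSS) Pc); near=> n => /=.
  rewrite [leRHS]theta_abs_rec lerD2r ler_peMl //; first exact/ltW/theta_abs_gt0.
  by rewrite -[1]/(1%:~R) ler_int cf_digit_ge1.
rewrite gerDl => Lle0.
by have <- : L = 0 by apply/le_anti; rewrite L0 Lle0.
Unshelve. all: by end_near. Qed.


(** * Tail intervals and their subdivision by the leading digit *)

(* The half-open interval of all values of an admissible tail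
   sum_(k > i) c_k theta_(k-1); the flag b says that c_i <> 0. *)
Definition tail_itv (i : nat) (b : bool) (s : R) : bool :=
  let e := if b then P i.+1 else 0 in
  if odd i then - P i + e <= s < P i.+1 else - P i.+1 <= s < P i - e.

Lemma theta_oddE i :
  T i.+1 = if odd i then - P i.+1 else P i.+1.
Proof. by rewrite theta_absE -signr_odd /= negbK; case: odd; rewrite ?mulN1r ?mul1r. Qed.

Lemma tail_itv_norm_le i b s : tail_itv i b s -> `|s| <= P i.
Proof.
have := theta_abs_gt0 i.+1; have := theta_abs_lt i; rewrite /tail_itv ler_norml.
by case: (odd i); case: b => ? ? /andP[? ?]; apply/andP; split; lra.
Qed.

Lemma tail_itv0 i b : tail_itv i b 0.
Proof.
have := theta_abs_gt0 i.+1; have := theta_abs_lt i; rewrite /tail_itv.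
by case: (odd i); case: b => ? ?; apply/andP; split; lra.
Qed.

(** Let i be even, p = P_(i+1), q = P_(i+2). Digit 0 contributes [-p, q) and digit c >= 1
    contributes [(c-1)p + q, cp + q). As P_i = ap + q, these pieces tile [-p, P_i), and forbidding c
    = a removes the last one. For odd i the endpoints are negated, but the left end stays the closed
    one. *)
Lemma tail_itv_cons i (b : bool) (c : int) s :
  0 <= c <= a i.+1 -> (b -> c != a i.+1) -> tail_itv i.+1 (c != 0) s ->
  tail_itv i b (c%:~R * T i.+1 + s).
Proof.
move=> /andP[c0 ca] bc; have p0 := theta_abs_gt0 i.+1.
have q0 := theta_abs_gt0 i.+2; have pq := theta_abs_lt i.+1.
rewrite /tail_itv theta_oddE [odd i.+1]/= (theta_abs_rec i).
set p := P i.+1 in p0 pq *; set q := P i.+2 in q0 pq *; set A := a _ in ca bc *.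
(* The bounds on c are multiplied by p beforehand, so that what remains is linear in the products Ap
   and cp. *)
have {ca} [cp1 cp2] : 0 <= (A%:~R - c%:~R) * p /\ (b -> 0 <= (A%:~R - c%:~R - 1) * p).
  split=> [|/bc cA]; rewrite mulr_ge0 ?(ltW p0) //.
    by rewrite subr_ge0 ler_int.
  have : 1 + c <= A by lia.
  by rewrite -(ler_int R) intrD subr_ge0 lerBrDr.
move: cp1 cp2; case: eqVneq => [->|cn0] /= cp1 cp2; last have cp0 : 0 <= (c%:~R - 1) * p.
- rewrite mul0r add0r; rewrite subr0 in cp1 cp2.
  by case: (odd i); case: b bc cp2 => _ /= cp2; try have {}cp2 := cp2 isT;
    move=> /andP[? ?]; apply/andP; split; lra.
- by rewrite mulr_ge0 ?(ltW p0) // -[1]/(1%:~R) -intrB ler0z; lia.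
by case: (odd i); case: b bc cp2 => _ /= cp2; try have {}cp2 := cp2 isT;
    move=> /andP[? ?]; apply/andP; split; lra.
Qed.

Lemma tail_itv_uncons i (b : bool) s : tail_itv i b s ->
  exists c : int, [/\ 0 <= c <= a i.+1, b -> c != a i.+1
    & tail_itv i.+1 (c != 0) (s - c%:~R * T i.+1)].
Proof.
have p0 := theta_abs_gt0 i.+1; have q0 := theta_abs_gt0 i.+2.
have pq := theta_abs_lt i.+1; have A1 := cf_digit_ge1 i.+1.
rewrite /tail_itv theta_oddE [odd i.+1]/= (theta_abs_rec i).
set p := P i.+1 in p0 pq *; set q := P i.+2 in q0 pq *; set A := a _ in A1 *.
case: (odd i) => /= /andP[s1 s2].
  have [sq|sq] := leP (- s) q.
    exists 0; rewrite eqxx lexx mul0r subr0 /=; split.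
    - by rewrite (le_trans _ A1).
    - by move=> _; rewrite lt_eqF // (lt_le_trans _ A1).
    - by apply/andP; split; lra.
  (* For odd i the piece of digit m >= 1 is [-mp - q, -(m-1)p - q); its closed left end makes m a
     ceiling. *)
  set m := Num.ceil ((- s - q) / p); have /andP[] := ceil_itv ((- s - q) / p).
  rewrite -/m ler_pdivrMr // ltr_pdivlMr // intrB => m1 m2.
  have m0 : 0 < m by rewrite ceil_gt0 divr_gt0 ?subr_gt0.
  have mA : m <= A - b%:Z.
    suff : (m - 1 - (A - b%:Z))%:~R * p < 0 by rewrite pmulr_llt0 // ltrz0; lia.
    by rewrite !intrB; case: b s1 s2 => /= s1 s2; lra.
  exists m; rewrite (_ : m != 0 = true); last by lia.
  split; [lia | by move=> bt; rewrite bt in mA; lia |].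
  by apply/andP; split; lra.
have [sq|sq] := ltP s q.
  exists 0; rewrite eqxx lexx mul0r subr0 /=; split.
  - by rewrite (le_trans _ A1).
  - by move=> _; rewrite lt_eqF // (lt_le_trans _ A1).
  - by apply/andP; split; lra.
(* For even i the piece [mp + q, (m+1)p + q) belongs to digit m + 1, hence the shift. *)
set m := Num.floor ((s - q) / p); have /andP[] := floor_itv ((s - q) / p).
rewrite -/m ler_pdivlMr // ltr_pdivrMr // intrD => m1 m2.
have m0 : 0 <= m by rewrite floor_ge0 divr_ge0 ?subr_ge0 // ltW.
have mA : m + 1 <= A - b%:Z.
  suff : (m - (A - b%:Z))%:~R * p < 0 by rewrite pmulr_llt0 // ltrz0; lia.
  by rewrite !intrB; case: b s1 s2 => /= s1 s2; lra.
exists (m + 1); rewrite (_ : m + 1 != 0 = true); last by lia.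
split; [lia | by move=> bt; rewrite bt in mA; lia |].
by rewrite intrD; apply/andP; split; lra.
Qed.

(** If c < d and i is even, the piece of c lies below cp + q, and that of d starts at (d-1)p + q >=
    cp + q; odd i is symmetric. *)
Lemma tail_itv_uncons_inj i (c d : int) s : 0 <= c -> 0 <= d ->
  tail_itv i.+1 (c != 0) (s - c%:~R * T i.+1) ->
  tail_itv i.+1 (d != 0) (s - d%:~R * T i.+1) -> c = d.
Proof.
wlog : c d / c <= d => [wl|cd] c0 d0 cs ds.
  by have [cd|/ltW dc] := leP c d; [|apply/esym]; apply: wl.
have [//|cNd] := eqVneq c d; exfalso.
have dn0 : d != 0 by lia.
have p0 := theta_abs_gt0 i.+1.
have q0 := theta_abs_gt0 i.+2; have pq := theta_abs_lt i.+1.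
have cdp : c%:~R * P i.+1 + P i.+1 <= d%:~R * P i.+1.
  by rewrite -{2}[P i.+1]mul1r -mulrDl ler_pM2r // -[1]/(1%:~R) -intrD ler_int; lia.
have : (0 : R) < 0; last by rewrite ltxx.
move: cs ds; rewrite dn0 /tail_itv theta_oddE [odd i.+1]/=.
by case: (odd i) => /=; case: (c != 0) => /andP[? ?] /andP[? ?]; lra.
Qed.

(** * Digit sequences: convergence, range, uniqueness, existence *)

(* Digit strings of either length are encoded as total sequences, zero after
   the limit; the convention d_0 = 1 subsumes the constraint c_1 <= a_1 - 1
   under condition (ii). *)
Definition digit_seq (d : nat -> int) : Prop :=
  [/\ d 0%N = 1, forall i, 0 <= d i.+1 <= a i.+1
    & forall i, d i != 0 -> d i.+1 != a i.+1].

(** Sequences that vanish eventually satisfy this automatically, since every digit a_k is at least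
    1; thus one condition serves both lengths. *)
Definition odd_defect (d : nat -> int) : Prop :=
  forall n, exists2 k, (n <= k)%N & odd k /\ d k <= a k - 1.

Definition psum (d : nat -> int) (n : nat) : R :=
  \sum_(1 <= k < n.+1) (d k)%:~R * T k.

Lemma psumS d n : psum d n.+1 = psum d n + (d n.+1)%:~R * T n.+1.
Proof. by rewrite /psum big_nat_recr. Qed.

Lemma psum0 d : psum d 0 = 0.
Proof. by rewrite /psum big_geq. Qed.

Lemma psum_tail_itv d i n : digit_seq d ->
  tail_itv i (d i != 0) (psum d (n + i) - psum d i).
Proof.
move=> [_ dge dM]; elim: n i => [|n IH] i; first by rewrite subrr tail_itv0.
have -> : psum d (n.+1 + i) - psum d i =
    (d i.+1)%:~R * T i.+1 + (psum d (n + i.+1) - psum d i.+1).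
  by rewrite addSnnS psumS; ring.
by apply: tail_itv_cons => //; exact: dM.
Qed.

(** The series converges absolutely: its terms are bounded by a_(n+1) P_(n+1) = P_n - P_(n+2), which
    telescopes. *)
Lemma psum_cvg d : digit_seq d -> cvgn (psum d).
Proof.
move=> [_ dge _]; pose u k : R := (d k.+1)%:~R * T k.+1.
have -> : psum d = series u by apply/funext => n; rewrite /psum big_add1.
apply: normed_cvg; apply: nondecreasing_is_cvgn.
  by apply/nondecreasing_seqP => n; rewrite /= seriesSr lerDl.
exists (P 0 + P 1) => _ [n _ <-].
suff : [normed series u] n <= P 0 + P 1 - P n - P n.+1.
  move/le_trans; apply; have := theta_abs_gt0 n; have := theta_abs_gt0 n.+1; lra.
elim: n => [|n IH]; first by rewrite /= /series /= big_geq //; lra.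
rewrite /= seriesSr /= in IH *.
suff : `|u n| <= P n - P n.+2 by lra.
have /andP[d0 da] := dge n; have p0 := theta_abs_gt0 n.+1.
rewrite /u theta_absE mulrCA normrMsign normrM.
rewrite ger0_norm ?ler0z // gtr0_norm // (theta_abs_rec n) addrK.
by rewrite ler_pM2r // ler_int.
Qed.

Lemma tail_itv_lim i b (u : nat -> R) l :
  (forall n, tail_itv i b (u n)) -> u @ \oo --> l ->
  let e := if b then P i.+1 else 0 in
  if odd i then - P i + e <= l <= P i.+1 else - P i.+1 <= l <= P i - e.
Proof.
rewrite /tail_itv => uI ul /=; case: (odd i) uI => uI; apply/andP; split;
  by [apply: (cvgr_to_ge ul); near=> n; case/andP: (uI n)
     |apply: (cvgr_to_le ul); near=> n; case/andP: (uI n) => _ /ltW].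
Unshelve. all: by end_near. Qed.

(** Passing to the limit only yields the closed interval. An odd defect makes the upper bound strict
    at some later index n, and [tail_itv_cons] carries this back to i. *)
Lemma digit_seq_tail_itv d (s : R) i : digit_seq d -> odd_defect d ->
  psum d @ \oo --> s -> tail_itv i (d i != 0) (s - psum d i).
Proof.
move=> dS dD ds; have [_ dge dM] := dS.
have tl j : s - psum d j = (d j.+1)%:~R * T j.+1 + (s - psum d j.+1).
  by rewrite psumS; ring.
have cl j : let e := if d j != 0 then P j.+1 else 0 in
    if odd j then - P j + e <= s - psum d j <= P j.+1
    else - P j.+1 <= s - psum d j <= P j - e.
  apply: (tail_itv_lim _ _ _ _ (fun n => psum_tail_itv d j n dS)).
  by apply: cvgB; [rewrite (cvg_shiftn j) | exact: cvg_cst].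
have [n [le_in nI]] : exists n, (i <= n)%N /\ tail_itv n (d n != 0) (s - psum d n).
  (* Starting at i + 2 ensures that j and j + 1 are both at least i; j is odd and the defect sits at
     j + 2. *)
  have [[|[|j]] // le_ij [/= jE dj]] := dD i.+2.
  rewrite negbK in jE; have p1 := theta_abs_gt0 j.+1; have p2 := theta_abs_gt0 j.+2.
  have t1 : s - psum d j.+1 <= P j.+1 - P j.+2.
    have := cl j.+2; rewrite /= negbK jE => /andP[_ t2].
    have := tl j.+1; rewrite theta_oddE /= jE /=.
    have := theta_abs_rec j.+1.
    have : (d j.+2)%:~R * P j.+2 <= ((a j.+2)%:~R - 1) * P j.+2.
      by rewrite ler_pM2r // -[1]/(1%:~R) -intrB ler_int.
    lra.
  have := cl j.+1; rewrite /= jE /=; have [dj0|djn0] := eqVneq (d j.+1) 0 => /= cl1.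
    exists j.+1; split; first by lia.
    by rewrite /tail_itv /= jE dj0 eqxx /=; apply/andP; split; lra.
  (* With a nonzero digit at j + 1, the bound [t1] is only the excluded end of the interval there.
     One index earlier that digit subtracts at least P_(j+1), leaving a value of at most
     -P_(j+2). *)
  exists j; split; first by lia.
  have := cl j; rewrite /= jE => /andP[t0 _].
  rewrite /tail_itv jE t0 /= tl theta_oddE jE.
  have /andP[dj_ge0 _] := dge j.
  have : P j.+1 <= (d j.+1)%:~R * P j.+1.
    by rewrite ler_peMl ?(ltW p1) // -[1]/(1%:~R) ler_int; lia.
  lra.
rewrite -(subnK le_in) in nI; elim: (n - i)%N nI => // m IH; rewrite addSn => nI.
by apply: IH; rewrite tl; apply: tail_itv_cons => //; exact: dM.
Qed.

Lemma digit_seq_uniq d d' (s : R) : digit_seq d -> odd_defect d ->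
  digit_seq d' -> odd_defect d' ->
  psum d @ \oo --> s -> psum d' @ \oo --> s -> d =1 d'.
Proof.
move=> dS dD dS' dD' ds ds' k; have [d0 dge _] := dS; have [d0' dge' _] := dS'.
suff [] : d k = d' k /\ psum d k = psum d' k by [].
elim: k => [|k [_ IH]]; first by rewrite d0 d0' !psum0.
suff E : d k.+1 = d' k.+1 by rewrite !psumS IH E.
apply: (@tail_itv_uncons_inj k _ _ (s - psum d k)).
- by case/andP: (dge k).
- by case/andP: (dge' k).
- by rewrite -addrA -opprD -psumS; exact: digit_seq_tail_itv.
- by rewrite IH -addrA -opprD -psumS; exact: digit_seq_tail_itv.
Qed.

(** [tail_itv_uncons] is iterated; the remainder after n digits is at most P_n in absolute value, so
    it tends to 0. *)
Lemma digit_seq_exists g : tail_itv 0 true g ->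
  exists d, [/\ digit_seq d, odd_defect d & psum d @ \oo --> g].
Proof.
move=> gI.
have /choice[f fP] (x : nat * bool * R) : exists c : int, tail_itv x.1.1 x.1.2 x.2 ->
    [/\ 0 <= c <= a x.1.1.+1, x.1.2 -> c != a x.1.1.+1
    & tail_itv x.1.1.+1 (c != 0) (x.2 - c%:~R * T x.1.1.+1)].
  case: (boolP (tail_itv x.1.1 x.1.2 x.2)) => [/tail_itv_uncons[c Hc]|_].
    by exists c.
  by exists 0.
(* The state is the current digit and the remainder; the initial 1 is the conventional d_0. *)
pose st := fix st n : int * R := if n is m.+1 then
  let c := f (m, (st m).1 != 0, (st m).2) in (c, (st m).2 - c%:~R * T m.+1)
  else (1, g).
pose d n := (st n).1.
have stI n : tail_itv n (d n != 0) (st n).2.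
  by elim: n => [//|n IH]; case: (fP (n, d n != 0, (st n).2) IH).
have stE n : (st n).2 = g - psum d n.
  by elim: n => [|n IH]; rewrite ?psum0 ?subr0 // psumS opprD addrA -IH.
have dS : digit_seq d.
  by split=> // n; case: (fP (n, d n != 0, (st n).2) (stI n)).
have st0 : (fun n => (st n).2) @ \oo --> (0 : R).
  apply: norm_cvg0; apply: (squeeze_cvgr _ (cvg_cst 0) theta_abs_cvg0).
  by near=> n; rewrite normr_ge0 (tail_itv_norm_le _ _ _ (stI n)).
have dg : psum d @ \oo --> g.
  rewrite -[g]subr0 (_ : psum d = fun n => g - (st n).2); last first.
    by apply/funext => n; rewrite stE opprB addrC subrK.
  by apply: cvgB => //; exact: cvg_cst.
exists d; split=> // n; apply: contrapT => nD.
have [_ dge dM] := dS.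
(* If every odd digit past n is maximal, the distance from the tail to the
   upper end of its interval is constant and positive along even indices. *)
have dmax k : (n <= k)%N -> ~~ odd k -> d k.+1 = a k.+1.
  move=> nk ok; apply: contrapT => dk; apply: nD; exists k.+1; first exact: leqW.
  by split=> //; have /andP[_] := dge k; have /eqP := dk; lia.
pose D k := P k - (st k).2.
have Dper m : D (n.*2 + m.*2)%N = D n.*2.
  elim: m => [|m <-]; first by rewrite addn0.
  rewrite doubleS !addnS; set k := (_ + _)%N.
  have [nk ok] : (n <= k)%N /\ ~~ odd k by rewrite /k oddD !odd_double; split=> //; lia.
  (* A nonzero digit here would forbid the next one, at an odd index, from being maximal. *)
  have d2 : d k.+2 = 0.
    apply/eqP/negPn/negP => /dM/eqP; apply.
    by apply: dmax; rewrite /= ?negbK // !leqW.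
  rewrite /D !stE !psumS d2 dmax // theta_oddE (negbTE ok) (theta_abs_rec k).
  by ring.
have D0 : D @ \oo --> (0 : R).
  by rewrite -[0]subr0; apply: cvgB => //; exact: theta_abs_cvg0.
have DN : 0 < D n.*2.
  have := stI n.*2; rewrite /tail_itv odd_double => /andP[_]; rewrite /D.
  by have := theta_abs_gt0 n.*2.+1; case: ifP => _; lra.
have [K _ HK] := cvgr_lt _ D0 _ DN.
by have := HK (n.*2 + K.*2)%N; rewrite /= Dper ltxx => /(_ ltac:(lia)).
Unshelve. all: by end_near. Qed.

Lemma tail_itv0E s : tail_itv 0 true s = (- alpha <= s < 1 - alpha).
Proof. by rewrite /tail_itv /= /theta_abs big_ord0 big_ord1. Qed.

End ContinuedFraction.

Arguments digit_seq {R}.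
Arguments odd_defect {R}.
Arguments psum {R}.

(** * Translation between strings with a limit and total sequences *)

Definition pad (l : option nat) (c : nat -> int) (k : nat) : int :=
  if k == 0%N then 1 else if is_index l k then c k else 0.

Lemma pad_index l c k : is_index l k -> pad l c k = c k.
Proof. by rewrite /pad; case: k => // k ->. Qed.

Lemma pad_left_admissible (R : realType) (alpha : R) l c :
  irrational alpha -> 0 < alpha < 1 -> left_admissible alpha l c ->
  digit_seq alpha (pad l c) /\ odd_defect alpha (pad l c).
Proof.
move=> irr alpha01 [[cge cl] cM [c1 codd]]; split; first split=> // [i|i].
- rewrite /pad /=; case: ifPn => [/cge//|_].
  by rewrite lexx (le_trans _ (cf_digit_ge1 _ _ irr alpha01 _)).
- rewrite {2}/pad /=; case: ifPn => [il di|_ _]; last first.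
    by rewrite lt_eqF // (lt_le_trans _ (cf_digit_ge1 _ _ irr alpha01 _)).
  apply/eqP => ci; case: i il di ci => [|i] il di ci.
    by have := c1 il; rewrite ci; lia.
  move/eqP: di; apply; rewrite /pad /=; case: ifP => // _.
  exact: (cM i.+2).
move=> n; case: l {cge cl cM c1} codd => [l _|/(_ erefl)/infinite_set_natP/(_ n)].
  (* An odd index beyond both n and the limit, where the padded digit is 0. *)
  exists (n + l).*2.+1; first lia.
  split; first by rewrite /= odd_double.
  rewrite /pad /= ifF; last by rewrite /is_index; lia.
  by rewrite subr_ge0 (cf_digit_ge1 _ _ irr).
by move=> [k nk [ki ok ck]]; exists k => //; rewrite pad_index.
Qed.

(** For a finite limit the padded partial sums are eventually constant, so convergence to s amounts
    to equality. *)
Lemma digit_sum_pad (R : realType) (alpha : R) l c (s : R) :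
  digit_sum_is alpha l c s <-> psum alpha (pad l c) @ \oo --> s.
Proof.
have Eidx n : (forall k, (0 < k <= n)%N -> is_index l k) ->
    psum alpha (pad l c) n = \sum_(1 <= k < n.+1) (c k)%:~R * cf_theta_pred alpha k.
  by move=> ln; apply: eq_big_nat => k /ln kl; rewrite pad_index.
case: l Eidx => [n|] Eidx /=; last first.
  by rewrite (_ : psum alpha _ = fun n =>
    \sum_(1 <= k < n.+1) (c k)%:~R * cf_theta_pred alpha k) //;
    apply/funext => n; apply: Eidx => k; rewrite /is_index; lia.
rewrite -Eidx; last by move=> k; rewrite /is_index; lia.
have ccvg : psum alpha (pad (Some n) c) @ \oo --> psum alpha (pad (Some n) c) n.
  apply: cvg_near_cst; near=> m.
  have /subnK <- : (n <= m)%N by near: m; exact: nbhs_infty_ge.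
  elim: (m - n)%N => // k IH; rewrite addSn psumS IH /pad /= ifF ?mul0r ?addr0 //.
  by rewrite /is_index; lia.
split=> [->//|scvg]; exact: (cvg_unique _ scvg ccvg).
Unshelve. all: by end_near. Qed.

(** The limit is infinite if infinitely many digits are nonzero; otherwise it is the least n past
    which all digits vanish, and minimality makes the last digit nonzero. *)
Lemma pad_surj (R : realType) (alpha : R) d :
  digit_seq alpha d -> odd_defect alpha d ->
  exists l, left_admissible alpha l d /\ pad l d =1 d.
Proof.
move=> [d0 dge dM] dD.
have dM2 k : (2 <= k)%N -> d k = cf_digit alpha k -> d k.-1 = 0.
  by case: k => // k _ /eqP dk; apply/eqP; apply: contraTT dk; exact: dM.
have d1 : d 1%N <= cf_digit alpha 1 - 1.
  have := dM 0%N; rewrite d0 => /(_ isT); have /andP[_] := dge 0%N; lia.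
have dge' l k : is_index l k -> 0 <= d k <= cf_digit alpha k by case: k.
have [dinf|] := pselect (infinite_set [set k | is_index None k /\ 1 <= d k]).
  exists None; split; last by case=> [|k]; rewrite /pad.
  split=> [|k k2 _|]; [by split=> [k /dge'|] | exact: dM2 |].
  split=> // _; apply/infinite_set_natP => n.
  by have [[|k] nk [ok dk]] := dD n; [|exists k.+1].
rewrite infinite_set_natP => /existsNP[m mP].
have : exists n, `[< forall k, (n < k)%N -> d k = 0 >].
  exists m; apply/asboolP => -[//|k] mk; apply: contrapT => dk; apply: mP.
  by exists k.+1; [exact: ltnW | split=> //=; have /andP[] := dge k; lia].
case/ex_minnP => n /asboolP d_gt n_min.
exists (Some n); split; last first.
  case=> [|k]; rewrite /pad //=; case: ifPn => // kn.
  by rewrite d_gt //; move: kn; rewrite /is_index; lia.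
split=> [|k k2 _|]; [split=> [k /dge'//|n1] | exact: dM2 | by []].
have dn0 : d n != 0.
  apply/eqP => dn; suff /n_min : `[< forall k, (n.-1 < k)%N -> d k = 0 >] by lia.
  apply/asboolP => k; rewrite prednK // leq_eqVlt => /predU1P[<- //|]; exact: d_gt.
by have /andP[] := dge n.-1; rewrite prednK //; lia.
Qed.

(** Condition (i) lets the padded sequence determine the limit: a finite string ends in a nonzero
    digit, an infinite one has nonzero digits arbitrarily far out. *)
Lemma pad_inj (R : realType) (alpha : R) l c l' c' : left_admissible alpha l c ->
  left_admissible alpha l' c' -> pad l c =1 pad l' c' ->
  l = l' /\ same_string l c c'.
Proof.
have none n b b' : left_admissible alpha (Some n) b ->
    left_admissible alpha None b' -> ~ pad (Some n) b =1 pad None b'.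
  move=> _ [[_ /infinite_set_natP/(_ n.+1)[k nk [k1 bk]]] _ _] /(_ k).
  by rewrite (pad_index None) // /pad /is_index !ifF; lia.
have le n n' b b' : left_admissible alpha (Some n) b ->
    left_admissible alpha (Some n') b' ->
    pad (Some n) b =1 pad (Some n') b' -> (n' <= n)%N.
  move=> _ [[_ b'n] _ _] /(_ n') E; rewrite leqNgt; apply/negP => nn'.
  move: E; rewrite (pad_index (Some n')); last by rewrite /is_index; lia.
  have := b'n ltac:(lia); rewrite /pad /is_index !ifF; lia.
move=> lc lc' E; have El : l = l'.
  case: l l' lc lc' E => [n|] [n'|] lc lc' E //.
  - congr Some; apply/anti_leq.
    by rewrite (le _ _ _ _ lc lc' E) (le _ _ _ _ lc' lc (fsym E)).
  - by case: (none _ _ _ lc lc' E).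
  - by case: (none _ _ _ lc' lc (fsym E)).
split=> // k lk; rewrite -(pad_index _ c _ lk) E pad_index //; by rewrite -El.
Qed.

Theorem theorem3p6 (R : realType) (alpha : R)
    (alpha_irr : irrational alpha) (alpha01 : 0 < alpha < 1) :
  (forall (l : option nat) (c : nat -> int),
     left_admissible alpha l c ->
     exists2 s : R, digit_sum_is alpha l c s & - alpha <= s < 1 - alpha)
  /\
  (forall gamma : R, - alpha <= gamma < 1 - alpha ->
     exists (l : option nat) (c : nat -> int),
       [/\ left_admissible alpha l c,
           digit_sum_is alpha l c gamma
         & forall (l' : option nat) (c' : nat -> int),
             left_admissible alpha l' c' ->
             digit_sum_is alpha l' c' gamma ->
             l' = l /\ same_string l c' c]).
Proof.
split=> [l c lc | gamma].
  have [dS dD] := pad_left_admissible _ _ _ _ alpha_irr alpha01 lc.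
  have s_lim := psum_cvg _ _ alpha_irr alpha01 _ dS.
  exists (limn (psum alpha (pad l c))); first exact/digit_sum_pad.
  (* The whole sum is the tail at index 0, where [pad] equals 1 and so sets the flag. *)
  rewrite -tail_itv0E -[limn _]subr0 -(psum0 _ alpha (pad l c)).
  exact: (digit_seq_tail_itv _ _ alpha_irr alpha01 _ _ 0 dS dD s_lim).
rewrite -tail_itv0E => /(digit_seq_exists _ _ alpha_irr alpha01)[d [dS dD d_lim]].
have [l [ld padl]] := pad_surj _ _ _ dS dD.
exists l, d; split=> // [|l' c' lc' /digit_sum_pad c'_lim].
  by apply/digit_sum_pad; rewrite (funext padl).
have [dS' dD'] := pad_left_admissible _ _ _ _ alpha_irr alpha01 lc'.
have E : pad l' c' =1 pad l d.
  move=> k; rewrite padl.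
  exact: (digit_seq_uniq _ _ alpha_irr alpha01 _ _ _ dS' dD' dS dD c'_lim d_lim).
have [-> cd] := pad_inj _ _ _ _ _ _ lc' ld E.
by split.
Qed.
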